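(* Let $k,r\ge 2$ be integers, and let $H$ be an $r$-uniform hypergraph. If every hyperedge of $H$ intersects at most $\frac1e\,k^{r-1}$ other hyperedges, then $H$ is $k$-colorable. In particular, if every vertex of $H$ has degree at most $\frac{k^{r-1}}{er}$, then $H$ is $k$-colorable.
   Context: A hypergraph $H=(V,E)$ consists of a set of vertices $V$ and a collection $E$ of subsets of $V$, called hyperedges. $H$ is $r$-uniform if each hyperedge has size $r$. The degree of a vertex is the number of hyperedges containing it. $H$ is $k$-colorable if there is a coloring of $V$ with $k$ colors such that no hyperedge is monochromatic. $e$ is the base of the natural logarithm. *)

(* Defs.v *)
From mathcomp Require Import all_boot all_order all_algebra.
From mathcomp Require Import all_classical all_reals all_analysis.

Set Implicit Arguments.
Unset Strict Implicit.
Unset Printing Implicit Defensive.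

Import Order.TTheory GRing.Theory Num.Theory.

Local Open Scope classical_set_scope.
Local Open Scope ring_scope.

(* Neither the vertex set nor the collection of hyperedges is assumed finite. *)
Record hypergraph := Hypergraph {
  vertex : Type;
  hyperedge : set (set vertex)
}.
Arguments hyperedge : clear implicits.

Definition uniform (r : nat) (H : hypergraph) : Prop :=
  forall A, hyperedge H A -> (A #= `I_r)%card.

Definition neighbors (H : hypergraph) (A : set (vertex H)) :
    set (set (vertex H)) :=
  [set B | hyperedge H B /\ B <> A /\ A `&` B !=set0].

(* [counting] is the cardinality of a set as an extended real, +oo for an
   infinite set, so a bound by a real number includes finiteness. *)
Definition degree (R : realType) (H : hypergraph) (v : vertex H) : \bar R :=
  counting [set A | hyperedge H A /\ A v].

Definition monochromatic (T C : Type) (f : T -> C) (A : set T) : Prop :=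
  exists c, forall x, A x -> f x = c.

Definition colorable (k : nat) (H : hypergraph) : Prop :=
  exists f : vertex H -> 'I_k,
    forall A, hyperedge H A -> ~ monochromatic f A.

(* Main.v *)
(* Colour the vertices uniformly at random; a hyperedge is monochromatic with
   probability p = k^(1-r) and depends only on its at most d <= 1/(ep)
   neighbours.  As only e p d <= 1 is assumed, rather than e p (d+1) <= 1, this
   needs Shearer's refinement of the local lemma: conditionally on the hyperedges
   of S not being monochromatic, a hyperedge with a neighbour outside S is
   monochromatic with probability at most x, where p <= x (1-x)^(d-1), and any
   other one with probability at most p / (1-x)^d < 1.  Probabilities are written
   as cardinalities of sets of colourings.  An infinite hypergraph is
   coloured by the limit, along an ultrafilter, of the colourings of its finite
   subhypergraphs. *)
Require Import Defs.
From mathcomp Require Import all_boot all_order all_algebra.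
From mathcomp Require Import ring lra.
Import Order.TTheory GRing.Theory Num.Theory.
Local Open Scope ring_scope.

(** * Counting good and bad colourings *)

Definition mono (T C : finType) (A : {set T}) (f : {ffun T -> C}) : bool :=
  [forall u in A, forall v in A, f u == f v].

Definition good (T C I : finType) (E : I -> {set T}) (S : {set I}) :
    {set {ffun T -> C}} :=
  [set f | [forall i in S, ~~ mono T C (E i) f]].

(** Its size relative to that of [good C E S] plays the role of a conditional probability given
    S. *)
Definition bad (T C I : finType) (E : I -> {set T}) (A : {set T})
    (S : {set I}) : {set {ffun T -> C}} :=
  [set f in good T C I E S | mono T C A f].

Arguments mono {T C} A f.
Arguments good {T} C {I} E S.
Arguments bad {T} C {I} E A S.

Lemma eq_mono (T C : finType) (A : {set T}) (f g : {ffun T -> C}) :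
  {in A, f =1 g} -> mono A f = mono A g.
Proof.
move=> fg; apply: eq_forallb => u; apply: implyb_id2l => uA.
by apply: eq_forallb => v; apply: implyb_id2l => vA; rewrite !fg.
Qed.

Lemma goodS (T C I : finType) (E : I -> {set T}) (S S' : {set I}) :
  S \subset S' -> good C E S' \subset good C E S.
Proof.
move=> /subsetP SS'; apply/subsetP => f; rewrite !inE => /forall_inP fS'.
by apply/forall_inP => i /SS' /fS'.
Qed.

Lemma badS (T C I : finType) (E : I -> {set T}) (A : {set T}) (S S' : {set I}) :
  S \subset S' -> bad C E A S' \subset bad C E A S.
Proof. by move=> SS'; rewrite /bad !setIdE setSI// goodS. Qed.

Lemma card_goodU1 (T C I : finType) (E : I -> {set T}) (i : I) (S : {set I}) :
  (#|good C E (i |: S)| + #|bad C E (E i) S| = #|good C E S|)%N.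
Proof.
rewrite -(cardsID [set f | mono (E i) f] (good C E S)) addnC; congr (_ + _)%N.
  by apply: eq_card => f; rewrite !inE.
apply: eq_card => f; rewrite !inE; apply/forall_inP/andP => [fS|[fi /forall_inP fS]].
  split; first by rewrite fS// setU11.
  by apply/forall_inP => j jS; rewrite fS// setU1r.
by move=> j /setU1P[->|/fS].
Qed.

(* Recolouring all but one vertex of A arbitrarily maps pairs (bad colouring,
   recolouring) injectively to good colourings: the colour of the vertex left
   alone determines the bad colouring on A. *)
Lemma card_bad_indep (T C I : finType) (E : I -> {set T}) (A : {set T})
    (S : {set I}) (r : nat) :
  #|A| = r.+1 -> {in S, forall j, [disjoint E j & A]} ->
  (#|bad C E A S| * #|C| ^ r <= #|good C E S|)%N.
Proof.
move=> cA disj; have /card_gt0P[a aA] : (0 < #|A|)%N by rewrite cA.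
have [->|[f0 _]] := set_0Vmem (bad C E A S); first by rewrite cards0.
have cA' : #|A :\ a| = r by apply/eqP; rewrite -eqSS -cA (cardsD1 a A) aA.
(* Recolourings are frozen at [f0 a] off [A :\ a], so that there are exactly [#|C| ^ r] of them. The
   default comes from a bad colouring because C may be empty. *)
pose G := [set g | g \in pffun_on (f0 a) (mem (A :\ a)) (mem C)].
have <- : #|G| = (#|C| ^ r)%N by rewrite cardsE card_pffun_on cA'.
rewrite -cardsX.
pose h (w : {ffun T -> C} * {ffun T -> C}) : {ffun T -> C} :=
  [ffun v => if v \in A :\ a then w.2 v else w.1 v].
rewrite -(@card_in_imset _ _ h) =>
    [|[f g] [f' g'] /setXP[/= fB gG] /setXP[/= fB' gG'] /ffunP e].
  apply/subset_leq_card/subsetP => _ /imsetP[[f g] /setXP[/= fB _] ->].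
  move: fB; rewrite !inE => /andP[/forall_inP fS _].
  apply/forall_inP => j jS; rewrite (@eq_mono _ _ _ _ f) ?fS// => v vj.
  by rewrite ffunE !inE (disjointFr (disj j jS) vj) andbF.
have hA v : v \in A :\ a -> g v = g' v.
  by move=> vA; have := e v; rewrite !ffunE /= vA.
have hN v : v \notin A :\ a -> f v = f' v.
  by move=> /negbTE vA; have := e v; rewrite !ffunE /= vA.
have constA f1 v : f1 \in bad C E A S -> v \in A -> f1 v = f1 a.
  rewrite inE => /andP[_ /forall_inP mA] vA.
  by have /forall_inP/(_ _ aA)/eqP := mA _ vA.
congr (_, _); apply/ffunP => v.
  have [/setD1P[_ vA]|/hN//] := boolP (v \in A :\ a).
  by rewrite !constA// hN// !inE eqxx.
have [/hA//|vA] := boolP (v \in A :\ a).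
by move: gG gG'; rewrite !inE => /pfamilyP[/supportP-> // _] /pfamilyP[/supportP-> //].
Qed.

(** * Shearer's refinement of the local lemma *)

Definition nbrs (T I : finType) (E : I -> {set T}) (i : I) : {set I} :=
  [set j | (j != i) && ~~ [disjoint E j & E i]].
Arguments nbrs {T I} E i.

(** Intersecting is symmetric, so i is itself a neighbour of j outside S. This missing neighbour is
    the gain from d to d - 1. *)
Lemma card_nbrsI (T I : finType) (E : I -> {set T}) (i j : I) (S : {set I}) :
  j \in nbrs E i -> i \notin S -> (#|nbrs E j :&: S| < #|nbrs E j|)%N.
Proof.
rewrite inE => /andP[ji dj] iS; apply: proper_card; rewrite properE subsetIl/=.
apply/subsetPn; exists i; first by rewrite inE eq_sym ji disjoint_sym.
by rewrite inE (negbTE iS) andbF.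
Qed.

(** Chain rule: the edges of S1 are added to S2 one at a time, and each keeps at least a fraction 1
    - x of the colourings left. *)
Lemma good_setU_ge (T C I : finType) (E : I -> {set T}) (R : realFieldType)
    (x : R) (S1 S2 : {set I}) : x <= 1 ->
  [disjoint S1 & S2] ->
  (forall j (S : {set I}), j \in S1 -> j \notin S -> S2 \subset S ->
     S \subset S1 :|: S2 ->
     #|bad C E (E j) S|%:R <= x * #|good C E S|%:R) ->
  (1 - x) ^+ #|S1| * #|good C E S2|%:R <= #|good C E (S1 :|: S2)|%:R.
Proof.
move=> x1; move: {2}#|S1| (erefl #|S1|) => n; elim: n => [|n IHn] in S1 *.
  by move=> /cards0_eq->; rewrite cards0 expr0 mul1r set0U.
move=> cS1 dS12 bnd; have /card_gt0P[j jS1] : (0 < #|S1|)%N by rewrite cS1.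
have jS2 : j \notin S2 by rewrite (disjointFr dS12 jS1).
have cS1' : #|S1 :\ j| = n.
  by apply/eqP; rewrite -eqSS -cS1 (cardsD1 j S1) jS1.
have sub : S1 :\ j :|: S2 \subset S1 :|: S2 by rewrite setSU// subD1set.
have IH : (1 - x) ^+ n * #|good C E S2|%:R <= #|good C E (S1 :\ j :|: S2)|%:R.
  rewrite -cS1'; apply: IHn => //.
    by apply: disjointWl dS12; exact: subD1set.
  move=> i S iS1 iS S2S SS; apply: bnd => //; first by case/setD1P: iS1.
  exact: subset_trans SS sub.
have eS : S1 :|: S2 = j |: (S1 :\ j :|: S2) by rewrite setUA setD1K.
have := bnd j (S1 :\ j :|: S2) jS1.
rewrite !inE eqxx/= jS2 subsetUr sub => /(_ isT isT isT) b.
have := card_goodU1 T C I E j (S1 :\ j :|: S2).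
rewrite -eS => /(congr1 (fun n => n%:R : R)); rewrite natrD => cg.
rewrite cS1 exprS -mulrA.
have : (1 - x) * ((1 - x) ^+ n * #|good C E S2|%:R) <=
       (1 - x) * #|good C E (S1 :\ j :|: S2)|%:R.
  by rewrite ler_wpM2l// subr_ge0.
by move=> /le_trans; apply; lra.
Qed.

(** Numerator and denominator of the conditional probability of edge i given S. Forgetting the
    neighbours of i leaves edges disjoint from it, hence independence; putting them back costs a
    factor 1 - x each. Edges have [r.+1] vertices, so 1/p is [#|C| ^ r]. *)
Lemma bad_split (T C I : finType) (E : I -> {set T}) (R : realFieldType)
    (x : R) (r : nat) (i : I) (S : {set I}) :
  (forall j, #|E j| = r.+1) -> x <= 1 -> i \notin S ->
  (forall j (S' : {set I}), i \notin S' -> j \in nbrs E i :&: S ->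
     j \notin S' -> S' \subset S ->
     #|bad C E (E j) S'|%:R <= x * #|good C E S'|%:R) ->
  let S2 := S :\: nbrs E i in
  #|bad C E (E i) S|%:R * (#|C| ^ r)%:R <= #|good C E S2|%:R :> R /\
  (1 - x) ^+ #|nbrs E i :&: S| * #|good C E S2|%:R <= #|good C E S|%:R.
Proof.
move=> cE x1 iS bnd S2.
have eS : (nbrs E i :&: S) :|: S2 = S by rewrite setIC setID.
split.
  rewrite -natrM ler_nat; apply: leq_trans (card_bad_indep _ _ _ _ _ _ _ (cE i) _).
    by rewrite leq_mul2r subset_leq_card ?orbT// badS// subsetDl.
  move=> j /setDP[jS]; rewrite inE negb_and negbK => /orP[/eqP ji|/negPn//].
  by rewrite -ji jS in iS.
rewrite -{2}eS; apply: good_setU_ge => //.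
  by rewrite -setI_eq0; apply/eqP/setP => j; rewrite !inE;
    case: (_ && ~~ _) => //=; rewrite andbF.
rewrite eS => j S' jS1 jS' _ S'S; apply: bnd => //.
by apply: contra iS => /(subsetP S'S).
Qed.

(** Induction on the size of S. The strict bound on the neighbours in S is inherited, since the
    smaller set S' lacks i, a neighbour of j. The quotient from [bad_split] is then at most p /
    (1-x)^(d-1) <= x. *)
Lemma card_bad_le (T C I : finType) (E : I -> {set T}) (R : realFieldType)
    (x : R) (d r : nat) :
  (forall j, #|E j| = r.+1) -> (forall j, #|nbrs E j| <= d)%N ->
  0 <= x <= 1 -> 1 <= (#|C| ^ r)%:R * (x * (1 - x) ^+ d.-1) ->
  forall (i : I) (S : {set I}), i \notin S -> (#|nbrs E i :&: S| < d)%N ->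
  #|bad C E (E i) S|%:R <= x * #|good C E S|%:R.
Proof.
move=> cE cN /andP[x0 x1] hx i S; have [n] := ubnP #|S|.
elim: n => // n IHn in i S * => cS iS cNS.
have [|b g] := bad_split T C I E R x r i S cE x1 iS.
  move=> j S' iS' /setIP[ij jS] jS' S'S.
  apply: IHn => //.
    apply: leq_trans (_ : #|S| <= n)%N; last by rewrite -ltnS.
    by rewrite proper_card// properE S'S/=; apply/subsetPn; exists j.
  exact: leq_trans (card_nbrsI _ _ _ _ _ _ ij iS') (cN j).
apply: le_trans (ler_wpM2l x0 g).
have e : (1 - x) ^+ d.-1 <= (1 - x) ^+ #|nbrs E i :&: S|.
  by apply: ler_wiXn2l; [lra|lra|rewrite -ltnS (ltn_predK cNS)].
set G := #|good C E _|%:R in b *; set q := (#|C| ^ r)%:R in hx b.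
have q0 : 0 < q.
  by rewrite lt0r ler0n andbT; apply/negP => /eqP q0; move: hx; rewrite q0; lra.
have G0 : 0 <= G by rewrite ler0n.
rewrite -(ler_pM2r q0) (le_trans b)//.
rewrite -{1}[G]mul1r (le_trans (ler_wpM2r G0 hx))//.
by rewrite [leRHS]mulrC -mulrA ler_pM2l// -mulrA ler_wpM2l// ler_wpM2r.
Qed.

(** Edges are added one by one, keeping [good] nonempty. All d neighbours of the new edge may
    already be present, so [card_bad_le] need not apply to it; a probability below 1 suffices,
    whence the strict hypothesis. *)
Lemma local_lemma_coloring (T C I : finType) (E : I -> {set T})
    (R : realFieldType) (x : R) (d r : nat) :
  (forall j, #|E j| = r.+1) -> (forall j, #|nbrs E j| <= d)%N ->
  0 <= x <= 1 -> 1 <= (#|C| ^ r)%:R * (x * (1 - x) ^+ d.-1) ->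
  1 < (#|C| ^ r)%:R * (1 - x) ^+ d -> (0 < #|C|)%N ->
  exists f : {ffun T -> C}, forall i, ~~ mono (E i) f.
Proof.
move=> cE cN x01 hx hd C0; have /andP[x0 x1] := x01.
suff good0 (S : {set I}) : (0 < #|good C E S|)%N.
  have /card_gt0P[f] := good0 [set: I].
  by rewrite inE => /forall_inP fE; exists f => i; apply: fE.
have [n] := ubnP #|S|; elim: n => // n IHn in S * => cS.
have [->|[i iS]] := set_0Vmem S.
  suff -> : good C E set0 = [set: {ffun T -> C}].
    by rewrite cardsT card_ffun expn_gt0 C0.
  by apply/setP => f; rewrite !inE; apply/forall_inP => j; rewrite inE.
have cSi : (#|S :\ i| < n)%N by move: cS; rewrite (cardsD1 i S) iS.
have iSi : i \notin S :\ i by rewrite !inE eqxx.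
have [|b g] := bad_split T C I E R x r i (S :\ i) cE x1 iSi.
  move=> j S' iS' /setIP[ij jS] jS' S'S.
  apply: (@card_bad_le _ _ _ _ _ _ d r) => //.
  exact: leq_trans (card_nbrsI _ _ _ _ _ _ ij iS') (cN j).
have := card_goodU1 T C I E i (S :\ i); rewrite setD1K// => cg.
suff : #|bad C E (E i) (S :\ i)|%:R < #|good C E (S :\ i)|%:R :> R.
  by rewrite ltr_nat -cg -{1}[#|bad _ _ _ _|]add0n ltn_add2r.
apply: lt_le_trans g.
have G0 : 0 < #|good C E (S :\ i :\: nbrs E i)|%:R :> R.
  by rewrite ltr0n IHn// (leq_ltn_trans _ cSi)// subset_leq_card// subsetDl.
set G := #|good C E (_ :\: _)|%:R in b G0 *; set q := (#|C| ^ r)%:R in hx hd b.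
have q0 : 0 < q.
  by rewrite lt0r ler0n andbT; apply/negP => /eqP q0; move: hx; rewrite q0; lra.
have e : (1 - x) ^+ d <= (1 - x) ^+ #|nbrs E i :&: (S :\ i)|.
  apply: ler_wiXn2l; [lra|lra|].
  by apply: leq_trans (cN i); rewrite subset_leq_card// subsetIl.
rewrite -(ltr_pM2r q0) (le_lt_trans b)//.
rewrite -{1}[G]mul1r (lt_le_trans (_ : _ < q * (1 - x) ^+ d * G))//.
  by rewrite ltr_pM2r.
by rewrite [leRHS]mulrC -mulrA ler_pM2l// ler_pM2r.
Qed.

From mathcomp Require Import finmap all_classical all_reals all_analysis.

(** * Choice of the weight x *)

(** This is (1 + 1/n)^n < e for n = m + 1, as 1 - 1/(n+1) is the inverse of 1 + 1/n. It is used with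
    d = m + 2. *)
Lemma expR1_gt (R : realType) (m : nat) :
  1 < expR 1 * (1 - m.+2%:R^-1) ^+ m.+1 :> R.
Proof.
have m1 : 0 < m.+1%:R :> R by rewrite ltr0n.
have m2 : 0 < m.+2%:R :> R by rewrite ltr0n.
have -> : 1 - m.+2%:R^-1 = (1 + m.+1%:R^-1 : R)^-1.
  by have m0 : 0 <= m%:R :> R := ler0n _ _; field; lra.
have -> : expR 1 = expR (m.+1%:R^-1 : R) ^+ m.+1.
  by rewrite -expRM_natl -mulr_natl mulfV// gt_eqF.
have y0 : 0 < 1 + m.+1%:R^-1 :> R by rewrite ltr_pwDl// invr_ge0 ltW.
rewrite -exprMn exprn_egt1// ltr_pdivlMr// mul1r.
by apply: expR_gt1Dx; rewrite invr_eq0 gt_eqF.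
Qed.

(* The weight is 1/d, except that 1 - 1/d would vanish for d = 1: there 1/q
   works, because q >= e > 2. *)
Lemma local_lemma_weight (R : realType) (d : nat) (q : R) :
  1 < q -> expR 1 * d%:R <= q ->
  exists x, [/\ 0 <= x <= 1, 1 <= q * (x * (1 - x) ^+ d.-1) &
               1 < q * (1 - x) ^+ d].
Proof.
move=> q1; have q0 : 0 < q by lra.
have qV : q * q^-1 = 1 by rewrite mulfV ?gt_eqF.
have e2 : 2 < expR 1 :> R by have := @expR_gt1Dx R 1 (oner_neq0 _); lra.
case: d => [|[|m]] dq.
(* For d = 0 both exponents vanish, since [0.-1] is 0. *)
- by exists 1; rewrite expr0; split; lra.
- exists q^-1; have q'0 : 0 < q^-1 by rewrite invr_gt0.
  by rewrite expr0 expr1; split; [nra|lra|lra].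
have m2 : 2 <= m.+2%:R :> R by rewrite ler_nat.
have mV : m.+2%:R * m.+2%:R^-1 = 1 :> R by rewrite mulfV// gt_eqF//; lra.
exists m.+2%:R^-1; have := @expR1_gt R m; rewrite [_ ^+ m.+2]exprS [_.-1]/=.
have m'0 : 0 < m.+2%:R^-1 :> R by rewrite invr_gt0; lra.
set x := m.+2%:R^-1 in mV m'0 *; set P := (1 - x) ^+ _ => eP.
have x2 : x <= 1 / 2 by nra.
have P0 : 0 < P by rewrite exprn_gt0//; lra.
have qx : expR 1 <= q * x.
  by move: (ler_wpM2r (ltW m'0) dq); rewrite -mulrA mV mulr1.
have h : expR 1 * P <= q * x * P by rewrite ler_wpM2r// ltW.
split; [lra|lra|].
(* As x <= 1/2, trading the factor x for 1 - x loses nothing, and strictness comes from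
   [expR1_gt]. *)
have : q * x * P <= q * ((1 - x) * P).
  by rewrite -mulrA ler_pM2l// ler_pM2r//; lra.
lra.
Qed.

(** * Compactness *)

(** Otherwise U would contain the complements of all fibres and, C being finite, their empty
    intersection. *)
Lemma ultrafilter_limit (T : Type) (C : finType) (U : set_system T) (g : T -> C) :
  UltraFilter U -> exists c, U [set t | g t = c]%classic.
Proof.
move=> UU; have PU := @ultra_proper _ _ UU.
apply: contrapT => /forallNP nU; apply: (@filter_not_empty _ U PU).
have UC c : U (~` [set t | g t = c])%classic.
  by have [/nU|] := in_ultra_setVsetC [set t | g t = c]%classic UU.
apply: filterS (filter_forall _ UC) => t /= gt.
exact: (gt (g t)).
Qed.

Lemma coloring_compactness (V : Type) (C : finType) (E : set (set V)) :
  (forall A, E A -> finite_set A) ->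
  (forall F : {fset set V}, (forall A, A \in F -> E A) ->
     exists f : V -> C, forall A, A \in F -> ~ monochromatic f A) ->
  exists f : V -> C, forall A, E A -> ~ monochromatic f A.
Proof.
move=> finE finC.
have [col colP] : {col : {fset set V} -> V -> C &
    forall F A, A \in F -> E A -> ~ monochromatic (col F) A}.
  apply: (@choice _ _ (fun F (f : V -> C) =>
    forall A, A \in F -> E A -> ~ monochromatic f A)) => F.
  have [A|f fP] := finC [fset A in F | `[< E A >]]%fset.
    by rewrite !inE => /andP[_ /asboolP].
  by exists f => A AF EA; apply: fP; rewrite !inE AF; apply/asboolP.
(* These sets generate the filter of properties that hold for all large enough finite F; U refines
   it. *)
pose up (F0 : {fset set V}) := [set F : {fset set V} | (F0 `<=` F)%fset]%classic.
have upF : ProperFilter (filter_from setT up).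
  apply: filter_from_proper => [|F _]; last by exists F; rewrite /up/=.
  apply: filter_fromT_filter => [|F F']; first by exists fset0.
  by exists (F `|` F')%fset => G; rewrite /up/= fsubUset => /andP.
have [U [UU upU]] := ultraFilterLemma upF.
have PU := @ultra_proper _ _ UU.
have [f fP] := choice (fun v => ultrafilter_limit _ _ U (fun F => col F v) UU).
exists f => A EA [c fc].
have UA : U [set F : {fset set V} | A \in F]%classic.
  by apply: upU; exists [fset A]%fset => // F; rewrite /up/= fsub1set.
(* Finiteness of A makes this a finite intersection of members of U, so some F containing A is
   coloured on A exactly as by f. *)
have UfA : U (\bigcap_(v in (A : set {classic V})) [set F | col F v = f v])%classic.
  have fA : finite_set (A : set {classic V}) := finE A EA.
  rewrite -(fset_setK fA); apply: filter_bigI => v _; exact: fP.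
have [F [AF colF]] : ([set F : {fset set V} | A \in F] `&`
    \bigcap_(v in (A : set {classic V})) [set F | col F v = f v] !=set0)%classic.
  exact: (filter_ex (filterI UA UfA)).
by apply: (colP F A AF EA); exists c => v Av; rewrite (colF v Av) fc.
Qed.

(** * From hypergraphs to finite families and back *)

Lemma counting_le (T : choiceType) (R : realType) (X : set T) (c : R) :
  (counting X <= c%:E)%E -> finite_set X /\ #|` fset_set X|%:R <= c.
Proof.
rewrite /counting; case: ifPn => [/asboolP fX|_]; last by rewrite leye_eq.
by rewrite lee_fin.
Qed.

Lemma finite_coloring (V : choiceType) (R : realType) (k r d : nat)
    (F : {fset set V}) : (2 <= k)%N -> (0 < r)%N ->
  (forall A, A \in F -> A #= `I_r.+1)%card ->
  (forall A, A \in F -> finite_set [set B | B \in F /\ B <> A /\ A `&` B !=set0] /\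
   (#|` fset_set [set B | B \in F /\ B <> A /\ A `&` B !=set0]| <= d)%N)%classic ->
  expR 1 * d%:R <= k%:R ^+ r :> R ->
  exists f : V -> 'I_k, forall A, A \in F -> ~ monochromatic f A.
Proof.
move=> k2 r0 cF nF dk.
(* The vertices lying on edges of F form a finite type, as the local lemma demands; F itself indexes
   the edges. *)
pose W : {fset V} := (\bigcup_(A <- F) fset_set A)%fset.
have finA A : A \in F -> finite_set A.
  by move=> AF; apply/finite_setP; exists r.+1; exact: cF.
have inW A v : A \in F -> A v -> v \in W.
  move=> AF Av; apply/bigfcupP; exists A; rewrite ?AF//.
  by rewrite in_fset_set ?inE//; exact: finA.
pose E (i : F) : {set W} := [set w : W | `[< val i (val w) >]].
have EP i w : reflect (val i (val w)) (w \in E i).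
  by rewrite finset.in_set; exact: asboolP.
have cE i : #|E i| = r.+1.
  rewrite -(card_fset_set (cF (val i) (valP i))) cardE -(size_map val).
  apply/perm_size/uniq_perm; rewrite ?(map_inj_uniq val_inj) ?enum_uniq//.
  move=> v; rewrite in_fset_set; last exact: finA (valP i).
  apply/mapP/idP => [[w]|/set_mem iv].
    by rewrite mem_enum => /EP iw ->; exact: mem_set.
  by exists [` inW _ _ (valP i) iv]%fset => //; rewrite mem_enum; exact/EP.
have cN i : (#|nbrs E i| <= d)%N.
  have [fN cNi] := nF (val i) (valP i).
  apply: leq_trans cNi; rewrite cardE -(size_map val).
  apply: uniq_leq_size; first by rewrite (map_inj_uniq val_inj) enum_uniq.
  move=> B /mapP[j]; rewrite mem_enum finset.in_set => /andP[ji /pred0Pn[w]].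
  move=> /andP[/EP jw /EP iw] ->; rewrite in_fset_set//; apply: mem_set.
  split; first exact: valP.
  split; first by move=> /val_inj ij; rewrite ij eqxx in ji.
  by exists (val w).
have q1 : 1 < k%:R ^+ r :> R by rewrite exprn_egt1 -?lt0n// ltr1n.
have [x [x01 hx hd]] := @local_lemma_weight R d (k%:R ^+ r) q1 dk.
have [|||f fP] := local_lemma_coloring W 'I_k F E R x d r cE cN x01.
- by rewrite card_ord natrX.
- by rewrite card_ord natrX.
- by rewrite card_ord (leq_trans _ k2).
(* An arbitrary colour for the vertices on no edge of F. *)
pose c0 := Ordinal (leq_trans (isT : 0 < 2)%N k2).
exists (fun v => if insub v is Some w then f w else c0) => A AF [c mA].
move/negP: (fP [` AF]%fset); apply; apply/forall_inP => u /EP uA.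
apply/forall_inP => v /EP vA.
by have := mA _ uA; have := mA _ vA; rewrite !valK => -> ->.
Qed.

Lemma colorable_of_neighbors (R : realType) (k r : nat) (H : hypergraph) :
  (2 <= k)%N -> (2 <= r)%N -> uniform r H ->
  (forall A, hyperedge H A ->
     (counting (neighbors A) <= ((expR 1)^-1 * k%:R ^+ (r - 1) : R)%:E)%E) ->
  colorable k H.
Proof.
case: r => // r k2 r1; rewrite subn1/= => unifH nbH.
apply: coloring_compactness => [A /unifH Ar|F FH].
  by apply/finite_setP; exists r.+1.
set D := (expR 1)^-1 * k%:R ^+ r in nbH.
have D0 : 0 <= D by rewrite mulr_ge0 ?exprn_ge0// invr_ge0 expR_ge0.
(* A number of neighbours is an integer, so D may be rounded down. *)
apply: (@finite_coloring {classic (vertex H)} R k r (Num.trunc D)) => // [A AF|A AF|].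
- exact/unifH/FH.
- have [fN cN] := counting_le _ _ _ _ (nbH A (FH A AF)).
  have sub : ([set B | B \in F /\ B <> A /\ A `&` B !=set0] `<=` neighbors A)%classic.
    by move=> B [/FH BH ?]; split.
  split; first exact: sub_finite_set sub fN.
  rewrite truncn_ge_nat// (le_trans _ cN)// ler_nat.
  apply: fsubset_leq_card; rewrite -fset_set_sub//; exact: sub_finite_set sub fN.
have -> : k%:R ^+ r = expR 1 * D by rewrite mulrA mulfV ?mul1r// gt_eqF ?expR_gt0.
by rewrite ler_pM2l ?expR_gt0// truncn_le.
Qed.

(** Union bound: each neighbour of A contains one of the r vertices of A. *)
Lemma counting_neighbors_le (R : realType) (r : nat) (H : hypergraph) (D : R)
    (A : set (vertex H)) :
  (A #= `I_r)%card -> (forall v : vertex H, degree R v <= D%:E)%E ->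
  (counting (neighbors A) <= (r%:R * D)%:E)%E.
Proof.
move=> Ar deg; pose F (v : {classic (vertex H)}) : set (set (vertex H)) :=
  [set B | hyperedge H B /\ B v]%classic.
have fcF (v : {classic (vertex H)}) := counting_le _ _ _ _ (deg v).
have sub : (neighbors A `<=` \bigcup_(v in A) F v)%classic.
  by move=> B [BH [_ [v [Av Bv]]]]; exists v.
have fA : finite_set (A : set {classic (vertex H)}).
  by apply/finite_setP; exists r.
have fN : finite_set (neighbors A).
  by apply: sub_finite_set sub (bigcup_finite fA _) => v _; exact: (fcF v).1.
rewrite /counting asboolT// lee_fin.
set s := fset_set (A : set {classic (vertex H)}).
have : (#|` fset_set (neighbors A)| <=
    size (flatten [seq enum_fset (fset_set (F v)) | v <- s]))%N.
  apply: uniq_leq_size; first exact: fset_uniq.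
  move=> B; rewrite in_fset_set// => /set_mem /sub[v Av FB].
  apply/flatten_mapP; exists (v : {classic (vertex H)}).
    by rewrite in_fset_set//; exact: mem_set.
  by rewrite in_fset_set; [exact: mem_set|exact: (fcF v).1].
rewrite -(ler_nat R) => /le_trans; apply.
rewrite size_flatten sumnE !big_map natr_sum.
apply: (@le_trans _ _ (\sum_(v <- s) D)).
  by apply: ler_sum => v _; exact: (fcF v).2.
by rewrite big_const_seq count_predT iter_addr addr0 mulr_natl
  (@card_fset_set {classic (vertex H)} _ _ Ar).
Qed.

Theorem theorem12 (R : realType) (k r : nat) (hk : (2 <= k)%N) (hr : (2 <= r)%N)
    (H : hypergraph) (Hunif : uniform r H) :
  ((forall A, hyperedge H A ->
      (counting (neighbors A) <= ((expR 1)^-1 * k%:R ^+ (r - 1) : R)%:E)%E) ->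
    colorable k H) /\
  ((forall v : vertex H,
      (degree R v <= (k%:R ^+ (r - 1) / (expR 1 * r%:R) : R)%:E)%E) ->
    colorable k H).
Proof.
split=> [nb|deg]; apply: (@colorable_of_neighbors R k r H) => // A AH.
have r0 : r%:R != 0 :> R by rewrite pnatr_eq0 -lt0n (leq_trans _ hr).
have -> : (expR 1)^-1 * k%:R ^+ (r - 1) =
    r%:R * (k%:R ^+ (r - 1) / (expR 1 * r%:R)) :> R.
  by field; rewrite r0 gt_eqF// expR_gt0.
exact: counting_neighbors_le (Hunif A AH) deg.
Qed.
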